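(* Let $a\colon\mathbb{R}\to(0,\infty)$ be a locally bounded differentiable function with locally bounded derivative such that $\int_0^\infty a(x)^{-1}\,dx=\infty=\int_{-\infty}^0 a(x)^{-1}\,dx$, and let $\rho\colon\mathbb{R}\to(0,\infty)$ be a $C^\infty$-function. Let $S$ be the semigroup on $L_\infty(\mathbb{R})$ associated with $X=a\,d/dx$ (defined in the context), and let $d(x;y)=\big|\int_x^y a(z)^{-1}\,dz\big|$. Then the kernel $K$ of $S$ is given by $$K_t(x;y)=(4\pi t)^{-1/2}\,(a(y)\rho(y))^{-1}\,e^{-d(x;y)^2(4t)^{-1}}$$ for all $x,y\in\mathbb{R}$ and $t>0$. Moreover, $K_t$ is continuous and $\int_{\mathbb{R}}dy\,\rho(y)\,K_t(x;y)=1$ for all $x\in\mathbb{R}$ (and all $t>0$).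
   Context: For $x_0\in\mathbb{R}$ let $t\mapsto e^{tX}x_0$ be the unique maximal solution of $\dot x=a(x)$, $x(0)=x_0$; it is defined for all $t\in\mathbb{R}$ and satisfies $\int_{x_0}^{e^{tX}x_0}a(x)^{-1}dx=t$. The group $T$ on $L_\infty(\mathbb{R};\rho\,dx)=L_\infty(\mathbb{R})$ is $(T_t\varphi)(y)=\varphi(e^{-tX}y)$, a weak$^*$ continuous group of isometries. The semigroup $S$ is $$S_t=(4\pi t)^{-1/2}\int_{-\infty}^\infty ds\,e^{-s^2(4t)^{-1}}\,T_s\qquad(t>0)$$ (weak$^*$ integral); equivalently it is the semigroup whose generator (convention $S_t=e^{-tH}$) is the weak$^*$ closure of $-X_{\max}^2$, where $X_{\max}\varphi=a\varphi'$ on $D(X_{\max})=C_c^1(\mathbb{R})$. The kernel of $S$ is taken with respect to the measure $\rho\,dx$: $(S_t\varphi)(x)=\int_{\mathbb{R}}dy\,\rho(y)\,K_t(x;y)\,\varphi(y)$. *)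

(* Defs.v *)
From HB Require Import structures.
From mathcomp Require Import all_boot all_order all_algebra.
From mathcomp Require Import all_classical all_reals all_analysis.

Set Implicit Arguments.
Unset Strict Implicit.
Unset Printing Implicit Defensive.
Import Order.TTheory GRing.Theory Num.Theory.
Import numFieldNormedType.Exports.

Local Open Scope classical_set_scope.
Local Open Scope ring_scope.

Section definitions.
Context {R : realType}.
Implicit Types (a rho phi psi : R -> R) (s t x y : R).

Definition locally_bounded (f : R -> R) : Prop :=
  forall x, bounded_near f (nbhs x).

Definition smooth (f : R -> R) : Prop :=
  forall n x, derivable (f^`(n))%classic x 1.

Definition flow_curve a x0 : set (R -> R) :=
  [set u | u 0 = x0 /\ forall t, is_derive t 1 u (a (u t))].

(* [flow a t x0] is e^{tX} x0 for X = a d/dx. Under the standing assumptions on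
   [a] the maximal solution of x' = a(x), x(0) = x0 is defined on the whole line
   and is unique, so it is the unique element of [flow_curve a x0]. *)
Definition flow a t x0 : R := get (flow_curve a x0) t.

Definition flow_group a t phi : R -> R := fun y => phi (flow a (- t) y).

(* Since [rho] is positive and continuous, the measures rho dx and dx have the
   same null sets, hence the same L_oo space. Its elements are represented by
   functions rather than by almost-everywhere classes. *)
Definition Loo : {pred (R -> R)} := Lfun (@lebesgue_measure R) +oo%E.

Definition L1 rho : set (R -> R) :=
  [set psi | (@lebesgue_measure R).-integrable setT
               (fun x => (rho x * psi x)%:E)].

(* The duality between L_1(rho dx) and L_oo(rho dx). *)
Definition pairing rho psi phi : R :=
  \int[@lebesgue_measure R]_x (rho x * psi x * phi x).

(* [is_wstar_integral rho F Phi]: the weak* integral of F over the line, with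
   respect to Lebesgue measure, exists in L_oo and equals [Phi]. *)
Definition is_wstar_integral rho (F : R -> R -> R) (Phi : R -> R) : Prop :=
  Phi \in Loo /\
  forall psi, L1 rho psi ->
    (@lebesgue_measure R).-integrable setT
      (fun s => (pairing rho psi (F s))%:E) /\
    pairing rho psi Phi = \int[@lebesgue_measure R]_s pairing rho psi (F s).

(* Weak* integrals are determined only up to null sets; [get] picks a
   representative. *)
Definition wstar_integral rho (F : R -> R -> R) : R -> R :=
  get [set Phi | is_wstar_integral rho F Phi].

Definition semigroup a rho t phi : R -> R := fun x =>
  (Num.sqrt (4 * pi * t))^-1 *
  wstar_integral rho
    (fun s y => expR (- (s ^+ 2 / (4 * t))) * flow_group a s phi y) x.

Definition is_kernel rho (S : R -> (R -> R) -> R -> R) (K : R -> R -> R -> R)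
    : Prop :=
  forall t, 0 < t ->
    measurable_fun [set: R * R] (fun p : R * R => K t p.1 p.2) /\
    forall phi, phi \in Loo ->
      {ae @lebesgue_measure R, forall x,
        (@lebesgue_measure R).-integrable setT
          (fun y => (rho y * K t x y * phi y)%:E) /\
        S t phi x = \int[@lebesgue_measure R]_y (rho y * K t x y * phi y)}.

Definition oriented_integral (f : R -> R) x y : R :=
  if x <= y then \int[@lebesgue_measure R]_(z in `[x, y]) f z
  else - \int[@lebesgue_measure R]_(z in `[y, x]) f z.

Definition distX a x y : R := `| oriented_integral (fun z => (a z)^-1) x y |.

Definition heat_kernel a rho t x y : R :=
  (Num.sqrt (4 * pi * t))^-1 * (a y * rho y)^-1 *
  expR (- (distX a x y ^+ 2 / (4 * t))).

End definitions.

(* Main.v *)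
(* With T x the signed travel time from 0 to x, i.e. T' = 1/a, the hypotheses make T
   an increasing bijection of the line that turns the flow into translation:
   e^{tX} x = T^{-1}(T x + t). For fixed x the substitution s = T x - T y carries ds
   to dy / a(y) and e^{-sX} x to y, so the Gaussian average of s |-> phi(e^{-sX} x)
   is the integral of phi against the claimed kernel, and taking phi = 1 yields the
   normalization. Fubini identifies this pointwise average with the weak* integral,
   which is determined up to null sets. *)
Require Import Defs.
From HB Require Import structures.
From mathcomp Require Import all_boot all_order all_algebra.
From mathcomp Require Import all_classical all_reals all_analysis.
From mathcomp Require Import measurable_realfun ess_sup_inf.
From mathcomp Require Import ring lra.

Set Implicit Arguments.
Unset Strict Implicit.
Unset Printing Implicit Defensive.

Import Order.TTheory GRing.Theory Num.Theory.
Import numFieldNormedType.Exports.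

Local Open Scope classical_set_scope.
Local Open Scope ring_scope.

(** * Integration against the image under [h] of a measure with density [w] *)

Section weighted_change_of_variables.
Local Open Scope ereal_scope.
Context d1 d2 (X : measurableType d1) (Y : measurableType d2) (R : realType).
Variables (mu : {measure set X -> \bar R}) (nu : {measure set Y -> \bar R}).
Variables (h : X -> Y) (w : X -> R).
Hypotheses (mh : measurable_fun [set: X] h) (mw : measurable_fun [set: X] w).
Hypothesis w_ge0 : forall x, (0 <= w x)%R.
Hypothesis nuE : forall E, measurable E ->
  nu E = \int[mu]_(x in h @^-1` E) (w x)%:E.

Import HBNNSimple.

(** For an indicator function the equality is [nuE]. Linearity extends it to simple functions, and
    monotone convergence along increasing simple approximations gives it for [f]. *)
Lemma ge0_integral_weighted_pushforward (f : Y -> \bar R) :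
  measurable_fun [set: Y] f -> (forall y, 0 <= f y) ->
  \int[nu]_y f y = \int[mu]_x (f (h x) * (w x)%:E).
Proof.
move=> mf f0; pose f_ := nnsfun_approx measurableT mf.
have cvgf y : EFin (f_ n y) @[n --> \oo] --> f y.
  by apply: cvg_nnsfun_approx => // *; exact: f0.
have mfh n : measurable_fun [set: X] (fun x => (f_ n (h x) * w x)%:E).
  by apply/measurable_EFinP/measurable_funM => //; exact: measurableT_comp.
transitivity (limn (fun n => \int[nu]_y (f_ n y)%:E)).
  rewrite -monotone_convergence//.
  - by apply: eq_integral => y _; apply/esym/cvg_lim.
  - by move=> n; exact/measurable_EFinP.
  - by move=> n y _; rewrite lee_fin.
  - by move=> y _ m n mn; rewrite lee_fin; exact/lefP/nd_nnsfun_approx.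
transitivity (limn (fun n => \int[mu]_x (f_ n (h x) * w x)%:E)); last first.
  rewrite -monotone_convergence//.
  - apply: eq_integral => x _; apply/cvg_lim => //.
    under eq_fun do rewrite EFinM.
    by apply: cvgeZr.
  - by move=> n x _; rewrite lee_fin mulr_ge0.
  - move=> x _ m n mn; rewrite lee_fin ler_wpM2r//.
    exact/lefP/nd_nnsfun_approx.
congr (limn _); apply/funext => n.
rewrite integralT_nnsfun sintegralE.
(* Contribution of the level set of value [r]; the finitely many [g r] add up to the simple function
   composed with [h], times [w]. *)
pose g r x := (r * \1_(f_ n @^-1` [set r]) (h x) * w x)%R.
have g0 r x : (0 <= g r x)%R.
  by rewrite mulr_ge0 // -lee_fin; exact: nnfun_muleindic_ge0.
have mg r : measurable_fun [set: X] (EFin \o g r).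
  apply/measurable_EFinP/measurable_funM => //.
  apply: measurable_funM => //.
  by apply: measurableT_comp => //; exact: measurable_indic.
transitivity (\int[mu]_x (\sum_(r \in range (f_ n)) (g r x)%:E)); last first.
  apply: eq_integral => x _; rewrite fsumEFin//; congr EFin.
  by rewrite /g -mulr_fsuml -fimfunE.
rewrite ge0_integral_fsum//; last by move=> r x _; rewrite lee_fin.
apply: eq_fsbigr => r /set_mem[y _ yr].
have r0 : (0 <= r)%R by rewrite -yr.
rewrite nuE//; under [RHS]eq_integral do rewrite /g -mulrA EFinM.
have mE : measurable (h @^-1` (f_ n @^-1` [set r])).
  by rewrite -[X in measurable X]setTI; apply: mh.
rewrite ge0_integralZl_EFin//; last 2 first.
- by move=> x _; rewrite lee_fin mulr_ge0.
- apply/measurable_EFinP/measurable_funM => //.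
  by apply: measurableT_comp => //; exact: measurable_indic.
congr (_ * _); rewrite integral_mkcond/=; apply: eq_integral => x _.
rewrite patchE indicE.
have -> : (h x \in f_ n @^-1` [set r]) = (x \in h @^-1` (f_ n @^-1` [set r])).
  by apply/idP/idP; rewrite !inE.
by case: ifP => _; rewrite ?mul1r ?mul0r.
Qed.

End weighted_change_of_variables.

(** * The weighted image measure *)

Section weighted_pushforward.
Local Open Scope ereal_scope.
Context d1 d2 (X : measurableType d1) (Y : measurableType d2) (R : realType).
Variables (mu : {measure set X -> \bar R}) (h : X -> Y) (w : X -> R).

Definition weighted_pushforward (E : set Y) : \bar R :=
  \int[mu]_(x in h @^-1` E) (w x)%:E.

Hypotheses (mh : measurable_fun [set: X] h) (mw : measurable_fun [set: X] w).
Hypothesis w_ge0 : forall x, (0 <= w x)%R.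

Lemma weighted_pushforward0 : weighted_pushforward set0 = 0.
Proof. by rewrite /weighted_pushforward preimage_set0 integral_set0. Qed.

Lemma weighted_pushforward_ge0 E : 0 <= weighted_pushforward E.
Proof. by apply: integral_ge0 => x _; rewrite lee_fin. Qed.

Lemma weighted_pushforward_sigma_additive :
  semi_sigma_additive weighted_pushforward.
Proof.
move=> F mF tF mUF.
have mhF E : measurable E -> measurable (h @^-1` E).
  by move=> mE; rewrite -[X in measurable X]setTI; exact: mh.
rewrite /weighted_pushforward preimage_bigcup ge0_integral_bigcup//.
- by apply: is_cvg_ereal_nneg_natsum => n _; exact: weighted_pushforward_ge0.
- by move=> n; exact: mhF.
- exact/measurable_EFinP/measurable_funTS.
- by move=> x _; rewrite lee_fin.
- by move=> i j _ _ [x [Fi Fj]]; apply: (tF i j) => //; exists (h x).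
Qed.

End weighted_pushforward.

(** * Substitution in Lebesgue integrals over the line *)

Section lebesgue_change_of_variables.
Local Open Scope ereal_scope.
Context d (X : measurableType d) (R : realType).
Variables (nu : {measure set X -> \bar R}) (h : X -> R) (w : X -> R).
Notation mu := (@lebesgue_measure R).
Hypotheses (mh : measurable_fun [set: X] h) (mw : measurable_fun [set: X] w).
Hypothesis w_ge0 : forall x, (0 <= w x)%R.
Hypothesis h_itv : forall p q : R, (p < q)%R ->
  \int[nu]_(x in h @^-1` `]p, q]) (w x)%:E = (q - p)%:E.

(** Lebesgue measure is determined by its values on half-open intervals, and [h_itv] says that the
    weighted image measure has these values. *)
Lemma lebesgue_measure_weighted_pushforward (E : set (measurableTypeR R)) :
  measurable E -> mu E = weighted_pushforward nu h w E.
Proof.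
pose h' : X -> measurableTypeR R := h.
have mh' : measurable_fun [set: X] h' := mh.
pose m : {measure set (measurableTypeR R) -> \bar R} :=
  HB.pack (weighted_pushforward nu h' w)
    (isMeasure.Build _ _ _ (weighted_pushforward nu h' w)
       (weighted_pushforward0 nu h' w) (weighted_pushforward_ge0 nu h' w_ge0)
       (weighted_pushforward_sigma_additive mh' mw w_ge0)).
apply: (@lebesgue_measure_unique R m) => _ [[p q] _ <-].
rewrite lebesgue_measure_itv/= lte_fin; case: ifPn => [pq|].
  by apply: esym; exact: h_itv.
rewrite -leNgt => qp; rewrite /m/= set_itv_ge ?bnd_simp -?leNgt//.
by rewrite weighted_pushforward0.
Qed.

Lemma ge0_lebesgue_change_of_variables (f : R -> \bar R) :
  measurable_fun [set: R] f -> (forall y, 0 <= f y) ->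
  \int[mu]_y f y = \int[nu]_x (f (h x) * (w x)%:E).
Proof.
move=> mf f0; apply: ge0_integral_weighted_pushforward => // E mE.
exact: lebesgue_measure_weighted_pushforward.
Qed.

(** No integrability is assumed: each integral is by definition that of the positive part minus that
    of the negative part, and multiplication by a nonnegative weight commutes with taking these
    parts. *)
Lemma lebesgue_change_of_variables (f : R -> R) : measurable_fun [set: R] f ->
  \int[mu]_y (f y)%:E = \int[nu]_x (f (h x) * w x)%:E.
Proof.
move=> mf; have mEf : measurable_fun [set: R] (EFin \o f).
  exact/measurable_EFinP.
rewrite [LHS]integralE [RHS]integralE.
rewrite ge0_lebesgue_change_of_variables//; last exact: measurable_funepos.
rewrite ge0_lebesgue_change_of_variables//; last exact: measurable_funeneg.
congr (_ - _); apply: eq_integral => x _.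
- by rewrite !funeposE EFinM maxe_pMl ?mul0e ?lee_fin.
- by rewrite !funenegE EFinM -mulNe maxe_pMl ?mul0e ?lee_fin.
Qed.

End lebesgue_change_of_variables.

(** * The fundamental theorem of calculus for oriented integrals *)

Section oriented_integral.
Context {R : realType}.
Implicit Types (f F : R -> R) (x y u : R).
Notation mu := (@lebesgue_measure R).

Let itv_integrable f x y : continuous f -> mu.-integrable `[x, y] (EFin \o f).
Proof.
move=> cf; apply: continuous_compact_integrable; first exact: segment_compact.
exact: continuous_subspaceT.
Qed.

Let oriented_integral_shift f u x y : continuous f -> u < x -> u < y ->
  oriented_integral f x y =
  \int[mu]_(z in `[u, y]) f z - \int[mu]_(z in `[u, x]) f z.
Proof.
move=> cf ux uy; wlog xy : x y ux uy / x <= y.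
  move=> H; have [xy|yx] := leP x y; first exact: H.
  have := H _ _ uy ux (ltW yx).
  by rewrite /oriented_integral [x <= y]leNgt yx (ltW yx)/= => ->; rewrite opprB.
rewrite /oriented_integral xy Rintegral_itvB ?bnd_simp//; last 2 first.
- exact: itv_integrable.
- exact: ltW.
rewrite Rintegral_itv_obnd_cbnd//.
have := itv_integrable u y cf; apply: integrableS => //.
by apply: subset_itvr; rewrite bnd_simp ltW.
Qed.

(** The point [v] lies below both [x] and [u], so near [x] the oriented integral is an ordinary
    integral from [v] minus a constant, even when [x] is at or to the left of [u]. *)
Lemma is_derive_oriented_integral f u x : continuous f ->
  is_derive x 1 (oriented_integral f u) (f x).
Proof.
move=> cf; pose v := Num.min x u - 1.
have vx : v < x by rewrite /v ltrBlDr (@le_lt_trans _ _ x)// ?ltrDl// ge_min lexx.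
have vu : v < u by rewrite /v ltrBlDr (@le_lt_trans _ _ u)// ?ltrDl// ge_min lexx orbT.
have [dF F'] : derivable (fun y => \int[mu]_(z in `[v, y]) f z) x 1 /\
    (fun y => \int[mu]_(z in `[v, y]) f z)^`()%classic x = f x.
  apply: (@continuous_FTC1_closed _ f v x (x + 1)) => //.
  - by rewrite ltrDl.
  - exact: itv_integrable.
  - exact: cf.
apply: (@near_eq_is_derive _ _ _
  (fun y => \int[mu]_(z in `[v, y]) f z - \int[mu]_(z in `[v, u]) f z)).
- near=> y; rewrite (@oriented_integral_shift _ v)//.
  by near: y; exact: lt_nbhsr.
- rewrite -[X in is_derive _ _ _ X]subr0.
  apply: is_deriveB; rewrite -F' derive1E; exact/derivableP.
Unshelve. all: end_near. Qed.

(** The difference of the two antiderivatives has zero derivative, hence is constant; its value is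
    read off at [x], where the integral vanishes. *)
Lemma oriented_integralE f F x y : continuous f ->
  (forall x, is_derive x 1 F (f x)) -> oriented_integral f x y = F y - F x.
Proof.
move=> cf dF; have D (z : R) : is_derive z 1 (F - oriented_integral f x) 0.
  rewrite -(subrr (f z)); apply: is_deriveB.
  exact: is_derive_oriented_integral.
have /eqP := is_derive_0_is_cst y x D; rewrite !fctE.
have -> : oriented_integral f x x = 0.
  by rewrite /oriented_integral lexx set_itv1 Rintegral_set1.
by rewrite subr0 subr_eq addrC -subr_eq => /eqP <-.
Qed.

(** If [F] stayed below [M], the integrals over [[0, n]], equal to [F n - F 0], would be at most
    [M - F 0], and so would their limit, the infinite integral. *)
Lemma antiderivative_unbounded f F : continuous f -> (forall x, 0 <= f x) ->
  (forall x, is_derive x 1 F (f x)) ->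
  (\int[mu]_(x in `[0%R, +oo[) (f x)%:E = +oo)%E ->
  forall M, exists2 x, 0 <= x & M < F x.
Proof.
move=> cf f0 dF intf M; apply: contrapT => /forall2NP noM.
have FM x : 0 <= x -> F x <= M.
  by move=> x0; have [//|/negP] := noM x; rewrite -leNgt.
have : (\int[mu]_(x in `[0%R, +oo[) (f x)%:E <= (M - F 0)%:E)%E.
  rewrite itv_bndy_bigcup_BRight.
  have cvgint : (\int[mu]_(x in `[0%R, (0 + i%:R)%R]) (f x)%:E @[i --> \oo] -->
      \int[mu]_(x in \bigcup_i [set` `[0%R, (0 + i%:R)%R]]) (f x)%:E)%E.
    apply: ge0_nondecreasing_set_cvg_integral => //.
    - move=> m n mn; rewrite subsetEset; apply: subset_itvl.
      by rewrite bnd_simp lerD2l ler_nat.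
    - move=> i; apply/measurable_EFinP/measurable_funTS.
      exact: continuous_measurable_fun.
    - by move=> i x _; rewrite lee_fin.
  rewrite -(cvg_lim _ cvgint)//; apply: lime_le; first exact: cvgP cvgint.
  near=> n.
  have -> : (\int[mu]_(x in `[0%R, (0 + n%:R)%R]) (f x)%:E =
      (oriented_integral f 0 n%:R)%:E)%E.
    rewrite /oriented_integral ler0n add0r /Rintegral fineK//.
    exact: integrable_fin_num (itv_integrable _ _ cf).
  by rewrite (oriented_integralE _ _ cf dF) lee_fin lerD2r FM.
by rewrite intf.
Unshelve. all: end_near. Qed.

End oriented_integral.

(** * Travel time as a global coordinate, and the explicit flow *)

Section travel_time.
Context {R : realType}.
Variable a : R -> R.
Implicit Types x y s t : R.
Hypotheses (a_gt0 : forall x, 0 < a x) (a_continuous : continuous a).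
Notation mu := (@lebesgue_measure R).

Definition travel_time x : R := oriented_integral (fun z => (a z)^-1) 0 x.

Definition travel_time_inv s : R := get [set x | travel_time x = s].

Lemma continuous_inv_speed : continuous (fun z => (a z)^-1).
Proof. by move=> x; apply: continuousV; [rewrite gt_eqF|exact: a_continuous]. Qed.

Lemma is_derive_travel_time x : is_derive x 1 travel_time (a x)^-1.
Proof. exact/is_derive_oriented_integral/continuous_inv_speed. Qed.

Lemma distXE x y : distX a x y = `|travel_time x - travel_time y|.
Proof.
rewrite /distX (oriented_integralE _ _ continuous_inv_speed is_derive_travel_time).
exact: distrC.
Qed.

Lemma continuous_travel_time : continuous travel_time.
Proof.
move=> x; apply/differentiable_continuous/derivable1_diffP.
by have [] := is_derive_travel_time x.
Qed.

Lemma ltr_travel_time : {mono travel_time : x y / x < y}.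
Proof.
apply: leW_mono; apply: le_mono => x y xy.
apply: (@gtr0_derive1_lt_cc _ travel_time x y); rewrite ?in_itv/= ?lexx ?ltW//.
- by move=> z _; have [] := is_derive_travel_time z.
- move=> z _; rewrite derive1E.
  by have [_ ->] := is_derive_travel_time z; rewrite invr_gt0.
- exact/continuous_subspaceT/continuous_travel_time.
Qed.

Lemma ler_travel_time : {mono travel_time : x y / x <= y}.
Proof. by move=> x y; rewrite !leNgt ltr_travel_time. Qed.

Hypothesis a_int_pos :
  (\int[mu]_(x in `[0%R, +oo[) ((a x)^-1)%:E = +oo)%E.
Hypothesis a_int_neg :
  (\int[mu]_(x in `]-oo, 0%R]) ((a x)^-1)%:E = +oo)%E.

(** Divergence of the two integrals makes the travel time unbounded above and below; the
    intermediate value theorem does the rest. *)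
Lemma travel_time_surj s : exists x, travel_time x = s.
Proof.
have inva_ge0 x : 0 <= (a x)^-1 by rewrite invr_ge0 ltW.
have [y y0 sy] := antiderivative_unbounded continuous_inv_speed inva_ge0
  is_derive_travel_time a_int_pos s.
have cN : continuous (fun x => (a (- x))^-1).
  move=> x; apply: (@continuous_comp _ _ _ -%R (fun x => (a x)^-1)).
    exact: opp_continuous.
  exact: continuous_inv_speed.
(* Unboundedness below is unboundedness above of the reflected function, whose derivative has
   infinite integral over the positive half-line by [a_int_neg]. *)
have dN x : is_derive x 1 (fun x => - travel_time (- x)) (a (- x))^-1.
  rewrite -[X in is_derive _ _ _ X]opprK; apply: is_deriveN.
  rewrite -[X in is_derive _ _ _ X]mulrN1.
  apply: (is_derive1_comp (f := travel_time) (g := -%R)).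
  exact: is_derive_travel_time.
have [||z z0 sz] := antiderivative_unbounded cN _ dN _ (- s).
- by move=> x; exact: inva_ge0.
- rewrite -a_int_neg ge0_integration_by_substitution0//.
  + by under eq_integral do rewrite opprK.
  + have mN := continuous_measurable_fun cN.
    by apply: measurableT_comp.
  + by move=> r; rewrite lee_fin.
have zy : - z <= y by rewrite (le_trans _ y0)// oppr_le0.
have [||x _ <-] := @IVT _ travel_time (- z) y s zy.
- exact/continuous_subspaceT/continuous_travel_time.
- rewrite ltrN2 in sz; rewrite min_l ?max_r ?ler_travel_time// (ltW sz)/=.
  exact: ltW.
- by exists x.
Qed.

Lemma travel_time_invK : cancel travel_time_inv travel_time.
Proof. by move=> s; exact: (getPex (travel_time_surj s)). Qed.

Lemma travel_timeK : cancel travel_time travel_time_inv.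
Proof.
by move=> x; apply: (inc_inj ler_travel_time); rewrite travel_time_invK.
Qed.

(** By the inverse function rule the derivative is the reciprocal of [1 / a]; thus [travel_time_inv]
    is itself an integral curve of the field. *)
Lemma is_derive_travel_time_inv s :
  is_derive s 1 travel_time_inv (a (travel_time_inv s)).
Proof.
have := @is_derive_inverse _ travel_time travel_time_inv
  (a (travel_time_inv s))^-1 (travel_time_inv s).
rewrite travel_time_invK invrK; apply.
- by apply: (@filterE _ (nbhs (travel_time_inv s))); exact: travel_timeK.
- apply: (@filterE _ (nbhs (travel_time_inv s))).
  exact: continuous_travel_time.
- exact: is_derive_travel_time.
- by rewrite invr_eq0 gt_eqF.
Qed.

Lemma continuous_travel_time_inv : continuous travel_time_inv.
Proof.
move=> s; apply/differentiable_continuous/derivable1_diffP.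
by have [] := is_derive_travel_time_inv s.
Qed.

(* Uniqueness: along any solution u of u' = a(u), the function T (u t) - t is
   constant. *)
Lemma flowE t x : flow a t x = travel_time_inv (travel_time x + t).
Proof.
(* [get] selects a solution only if one exists; a time translate of [travel_time_inv] is
   exhibited. *)
have : flow_curve a x (fun t => flow a t x).
  apply: (@getPex _ (flow_curve a x)).
  exists (fun t => travel_time_inv (travel_time x + t)); split.
    by rewrite addr0 travel_timeK.
  move=> s; rewrite -[X in is_derive _ _ _ X]mulr1.
  apply: (is_derive1_comp (f := travel_time_inv)).
    exact: is_derive_travel_time_inv.
  rewrite -[X in is_derive _ _ _ X]add0r; apply: is_deriveD.
move=> [u0 du].
have D (s : R) : is_derive s 1 (fun s => travel_time (flow a s x) - s) 0.
  rewrite -(subrr 1); apply: is_deriveB.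
  rewrite -[X in is_derive _ _ _ X](@mulVf _ (a (flow a s x))) ?gt_eqF//.
  apply: (is_derive1_comp (f := travel_time)).
  exact: is_derive_travel_time.
have := is_derive_0_is_cst t 0 D.
rewrite u0 subr0 => /eqP; rewrite subr_eq => /eqP <-.
by rewrite travel_timeK.
Qed.

End travel_time.

(** * The Gaussian weight and its total mass *)

Section gaussian.
Context {R : realType}.
Implicit Types s t : R.
Notation mu := (@lebesgue_measure R).

Definition gaussian t s : R := expR (- (s ^+ 2 / (4 * t))).

Lemma gaussian_ge0 t s : 0 <= gaussian t s. Proof. exact: expR_ge0. Qed.

Lemma continuous_gaussian t : continuous (gaussian t).
Proof.
move=> s; apply: (@continuous_comp _ _ _ (fun s => - (s ^+ 2 / (4 * t))) expR).
  by apply: continuousN; apply: continuousM;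
    [exact: exprn_continuous|exact: cst_continuous].
exact: continuous_expR.
Qed.

Lemma measurable_gaussian t : measurable_fun [set: R] (gaussian t).
Proof. by apply: continuous_measurable_fun; exact: continuous_gaussian. Qed.

(** Up to its peak value, the weight is the centred normal density of variance [2 * t], which has
    mass one. *)
Lemma integral_gaussian t : 0 < t ->
  (\int[mu]_s (gaussian t s)%:E = (Num.sqrt (4 * pi * t))%:E)%E.
Proof.
move=> t0; pose sigma := Num.sqrt (2 * t).
have sigma2 : sigma ^+ 2 = 2 * t by rewrite sqr_sqrtr// mulr_ge0// ltW.
have sigma0 : sigma != 0 by rewrite gt_eqF// sqrtr_gt0 mulr_gt0.
have peakE : normal_peak sigma = (Num.sqrt (4 * pi * t))^-1.
  by rewrite /normal_peak sigma2; congr (Num.sqrt _)^-1; ring.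
have pos : 0 < Num.sqrt (4 * pi * t).
  by rewrite sqrtr_gt0 !mulr_gt0// pi_gt0.
have pdfE s : normal_pdf 0 sigma s =
    (Num.sqrt (4 * pi * t))^-1 * gaussian t s.
  rewrite normal_pdfE// peakE /normal_fun subr0 sigma2; congr (_ * expR _).
  by rewrite mulNr; congr (- (_ / _)); ring.
have := integral_normal_pdf (0 : R) sigma.
under eq_integral do rewrite pdfE.
under eq_integral do rewrite EFinM.
rewrite ge0_integralZl_EFin//; last 2 first.
- by move=> s _; rewrite lee_fin expR_ge0.
- by apply/measurable_EFinP; exact: measurable_gaussian.
move=> H; rewrite -[LHS]mul1e -[X in (X%:E * _)%E](mulfV (lt0r_neq0 pos)).
by rewrite EFinM -muleA H mule1.
Qed.

Lemma integrable_gaussian t : 0 < t ->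
  mu.-integrable [set: R] (EFin \o gaussian t).
Proof.
move=> t0; apply/integrableP; split.
  by apply/measurable_EFinP; exact: measurable_gaussian.
under eq_integral do rewrite /= ger0_norm ?gaussian_ge0//.
by rewrite integral_gaussian// ltry.
Qed.

End gaussian.

(** * The claimed kernel: substitution, continuity, measurability and normalization *)

Section heat_kernel.
Context {R : realType}.
Variables a rho : R -> R.
Implicit Types x y s t : R.
Notation mu := (@lebesgue_measure R).
Hypotheses (a_gt0 : forall x, 0 < a x) (a_continuous : continuous a).
Hypotheses (rho_gt0 : forall x, 0 < rho x) (rho_continuous : continuous rho).
Hypothesis a_int_pos :
  (\int[mu]_(x in `[0%R, +oo[) ((a x)^-1)%:E = +oo)%E.
Hypothesis a_int_neg :
  (\int[mu]_(x in `]-oo, 0%R]) ((a x)^-1)%:E = +oo)%E.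

Local Notation T := (travel_time a).
Local Notation Tinv := (travel_time_inv a).
Let cT : continuous T := continuous_travel_time a_gt0 a_continuous.
Let mT : measurable_fun [set: R] T := continuous_measurable_fun cT.
Let TinvK := travel_time_invK a_gt0 a_continuous a_int_pos a_int_neg.
Let minva : measurable_fun [set: R] (fun y => (a y)^-1) :=
  continuous_measurable_fun (continuous_inv_speed a_gt0 a_continuous).
Let inva_ge0 y : 0 <= (a y)^-1. Proof. by rewrite invr_ge0 ltW. Qed.

Lemma heat_kernelE t x y : heat_kernel a rho t x y =
  (Num.sqrt (4 * pi * t))^-1 * (a y * rho y)^-1 * gaussian t (T x - T y).
Proof. by rewrite /heat_kernel distXE// real_normK// num_real. Qed.

(** The density [rho] cancels, leaving the Gaussian in [s = T x - T y] times the Jacobian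
    [1 / a y]. *)
Lemma mul_heat_kernelE t x y : rho y * heat_kernel a rho t x y =
  (Num.sqrt (4 * pi * t))^-1 * (gaussian t (T x - T y) * (a y)^-1).
Proof.
rewrite heat_kernelE; move: (Num.sqrt _)^-1 => c.
by field; rewrite !gt_eqF.
Qed.

Let measurable_time_shift x : measurable_fun [set: R] (fun y => T x - T y).
Proof. exact: measurable_funB. Qed.

Let integral_travel_time x (p q : R) : p < q ->
  (\int[mu]_(y in (fun y => T x - T y)%R @^-1` `]p, q]) ((a y)^-1)%:E =
   (q - p)%:E)%E.
Proof.
(* The map is decreasing, so the closed end moves to the left; the change of endpoints below costs
   only a null set. *)
move=> pq; have -> : (fun y => T x - T y) @^-1` `]p, q] =
    `[Tinv (T x - q), Tinv (T x - p)[%classic.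
  apply/funext => y; apply/propext; rewrite /= !in_itv/=.
  rewrite -[Tinv _ <= y](ler_travel_time a_gt0 a_continuous) TinvK.
  rewrite -[y < Tinv _](ltr_travel_time a_gt0 a_continuous) TinvK.
  by split=> /andP[? ?]; apply/andP; split; lra.
rewrite integral_itv_bndo_bndc//; last exact/measurable_EFinP/measurable_funTS.
have le_Tinv : Tinv (T x - q) <= Tinv (T x - p).
  by rewrite -(ler_travel_time a_gt0)// !TinvK lerD2l lerN2 ltW.
have := oriented_integralE (Tinv (T x - q)) (Tinv (T x - p))
  (continuous_inv_speed a_gt0 a_continuous)
  (is_derive_travel_time a_gt0 a_continuous).
rewrite /oriented_integral le_Tinv !TinvK /Rintegral => H.
have -> : q - p = T x - p - (T x - q) by lra.
rewrite -H fineK//; apply: integrable_fin_num => //.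
apply: continuous_compact_integrable; first exact: segment_compact.
exact/continuous_subspaceT/continuous_inv_speed.
Qed.

(** The substitution [s = T x - T y]. Integrability is not assumed, so it can be applied to absolute
    values in order to prove integrability. *)
Lemma integral_time (f : R -> R) x : measurable_fun [set: R] f ->
  (\int[mu]_s (f s)%:E = \int[mu]_y (f (T x - T y) * (a y)^-1)%:E)%E.
Proof.
move=> mf; apply: lebesgue_change_of_variables => //.
- exact: measurable_time_shift.
- exact: integral_travel_time.
Qed.

Lemma continuous_heat_kernel t :
  continuous (fun p : R * R => heat_kernel a rho t p.1 p.2).
Proof.
under eq_fun do rewrite heat_kernelE.
have cfst (f : R -> R) (p : R * R) : continuous f ->
    f q.1 @[q --> p] --> f p.1.
  by move=> cf; apply: (cvg_comp fst f); [exact: cvg_fst|exact: cf].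
have csnd (f : R -> R) (p : R * R) : continuous f ->
    f q.2 @[q --> p] --> f p.2.
  by move=> cf; apply: (cvg_comp snd f); [exact: cvg_snd|exact: cf].
move=> p; apply: cvgM; first apply: cvgM.
- exact: cvg_cst.
- apply: cvgV; first by rewrite gt_eqF// mulr_gt0.
  by apply: cvgM; exact: csnd.
apply: (cvg_comp (fun q : R * R => T q.1 - T q.2) (gaussian t)).
  by apply: cvgB; [exact: cfst|exact: csnd].
exact: continuous_gaussian.
Qed.

Lemma measurable_heat_kernel t :
  measurable_fun [set: R * R] (fun p : R * R => heat_kernel a rho t p.1 p.2).
Proof.
under eq_fun do rewrite heat_kernelE.
apply: measurable_funM; first apply: measurable_funM => //.
  have : measurable_fun [set: R] (fun y => (a y * rho y)^-1).
    apply: continuous_measurable_fun => y.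
    apply: cvgV; first by rewrite gt_eqF// mulr_gt0.
    by apply: cvgM; [exact: a_continuous|exact: rho_continuous].
  by move=> mar; exact: (measurableT_comp mar measurable_snd).
apply: measurableT_comp; first exact: measurable_gaussian.
apply: measurable_funB; first exact: (measurableT_comp mT measurable_fst).
exact: (measurableT_comp mT measurable_snd).
Qed.

(** Undoing the substitution turns the integral into the Gaussian mass over its normalizing
    factor. *)
Lemma integral_heat_kernel t x : 0 < t ->
  (\int[mu]_y (rho y * heat_kernel a rho t x y)%:E = 1)%E.
Proof.
move=> t0; under eq_integral do rewrite mul_heat_kernelE EFinM.
rewrite ge0_integralZl_EFin//; last 2 first.
- by move=> y _; rewrite lee_fin mulr_ge0 ?gaussian_ge0.
- apply/measurable_EFinP/measurable_funM; last exact: minva.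
  exact: (measurableT_comp (@measurable_gaussian _ t) (measurable_time_shift x)).
rewrite -integral_time; last exact: measurable_gaussian.
by rewrite integral_gaussian// -EFinM mulVf// gt_eqF// sqrtr_gt0 !mulr_gt0// pi_gt0.
Qed.

End heat_kernel.

(** * Essentially bounded functions and their duality with integrable ones *)

Section Loo.
Context {R : realType}.
Implicit Types (u phi psi rho : R -> R) (M : R).
Notation mu := (@lebesgue_measure R).

Let lebesgue_measure_setT_gt0 : (0 < mu [set: R])%E.
Proof. by rewrite -set_itvNyy lebesgue_measure_itv/= ltry. Qed.

Lemma measurable_Loo phi : phi \in Loo -> measurable_fun [set: R] phi.
Proof. by rewrite inE => /andP[/[!inE]]. Qed.

Lemma Loo_ae_bounded phi : phi \in Loo ->
  exists2 M : R, 0 <= M & {ae mu, forall x, `|phi x| <= M}.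
Proof.
rewrite inE => /andP[_ /[!inE]/=]; rewrite /finite_norm unlock /Lnorm.
rewrite lebesgue_measure_setT_gt0 => /ess_supr_bounded[M phiM].
exists (Num.max 0 M); first by rewrite le_max lexx.
by apply: filterS phiM => x /= xM; rewrite le_max xM orbT.
Qed.

Lemma bounded_Loo phi M : measurable_fun [set: R] phi ->
  (forall x, `|phi x| <= M) -> phi \in Loo.
Proof.
move=> mphi phiM; rewrite inE; apply/andP; split; rewrite inE//=.
rewrite /finite_norm unlock /Lnorm lebesgue_measure_setT_gt0.
apply: (@le_lt_trans _ _ M%:E); last exact: ltry.
by apply: ess_sup_ler => x; rewrite lee_fin.
Qed.

Lemma integrable_mul_Loo u phi : mu.-integrable [set: R] (EFin \o u) ->
  phi \in Loo -> mu.-integrable [set: R] (fun x => (u x * phi x)%:E).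
Proof.
move=> iu Lphi; have [M M0 phiM] := Loo_ae_bounded Lphi.
have mphi := measurable_Loo Lphi.
have mu_u : measurable_fun [set: R] u.
  by have /measurable_int/measurable_EFinP := iu.
have mup : measurable_fun [set: R] (fun x => u x * phi x).
  exact: measurable_funM.
have := integrableZl measurableT M iu.
move=> /integrableP[mMu iMu]; apply/integrableP; split.
  by apply: measurableT_comp.
apply: le_lt_trans iMu; apply: ae_ge0_le_integral => //=.
- by do 2 apply: measurableT_comp => //.
- by have := measurableT_comp (@abse_measurable R setT) mMu.
apply: (@filterS _ _ (ae_filter_ringOfSetsType mu) _ _ _ phiM) => x xM _.
by rewrite lee_fin !normrM mulrC ler_wpM2r// (le_trans xM)// ler_norm.
Qed.

(* Test against the L_1 function g (phi1 - phi2) / rho, with g a Gaussian: this gives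
   zero for the integral of g (phi1 - phi2)^2. *)
Lemma pairing_inj rho phi1 phi2 : (forall x, 0 < rho x) ->
  phi1 \in Loo -> phi2 \in Loo ->
  (forall psi, L1 rho psi -> pairing rho psi phi1 = pairing rho psi phi2) ->
  {ae mu, forall x, phi1 x = phi2 x}.
Proof.
move=> rho_gt0 Lphi1 Lphi2 phi12.
(* [D] is only essentially bounded; the Gaussian factor makes it integrable and, being positive,
   loses no information about its zeros. *)
pose D x := phi1 x - phi2 x; pose g x := gaussian 1 x * D x.
have ig1 := integrable_gaussian (@ltr01 R).
have ig : mu.-integrable [set: R] (EFin \o g).
  have := integrableB measurableT (integrable_mul_Loo ig1 Lphi1)
    (integrable_mul_Loo ig1 Lphi2).
  apply: eq_integrable => // x _.
  by rewrite /g /D/= mulrBr EFinB.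
have rhoK x : rho x * (g x / rho x) = g x by rewrite mulrC divfK// gt_eqF.
have Lpsi : L1 rho (fun x => g x / rho x).
  by rewrite /L1/=; under eq_fun do rewrite rhoK.
have int0 : \int[mu]_x (g x * D x) = 0.
  have := phi12 _ Lpsi; rewrite /pairing => /eqP; rewrite -subr_eq0.
  rewrite -RintegralB//; last 2 first.
  - by apply: eq_integrable (integrable_mul_Loo ig Lphi1) => // x _; rewrite /= rhoK.
  - by apply: eq_integrable (integrable_mul_Loo ig Lphi2) => // x _; rewrite /= rhoK.
  move=> /eqP H; rewrite -[RHS]H; apply: eq_Rintegral => x _.
  by rewrite rhoK -mulrBr.
have igD : mu.-integrable [set: R] (fun x => (g x * D x)%:E).
  have := integrableB measurableT (integrable_mul_Loo ig Lphi1)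
    (integrable_mul_Loo ig Lphi2).
  by apply: eq_integrable => // x _; rewrite /D/= mulrBr EFinB.
have gD0 x : 0 <= g x * D x.
  by rewrite -mulrA mulr_ge0 ?gaussian_ge0// -expr2 sqr_ge0.
have : (\int[mu]_x `|(g x * D x)%:E| = 0)%E.
  under eq_integral do rewrite /= ger0_norm//.
  by rewrite -[LHS]fineK ?(integrable_fin_num _ igD)//; congr EFin.
move=> /(ae_eq_integral_abs _ measurableT (measurable_int _ igD)).
apply: filterS => x /= /(_ I) [] /eqP.
rewrite /g -mulrA mulf_eq0 gt_eqF ?expR_gt0//= mulf_eq0 orbb subr_eq0.
by move/eqP.
Qed.

End Loo.

(** * The weak* integral as a pointwise Gaussian average *)

Section weak_star_integral.
Context {R : realType}.
Variables a rho : R -> R.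
Implicit Types (x y s t : R) (phi psi : R -> R).
Notation mu := (@lebesgue_measure R).
Hypotheses (a_gt0 : forall x, 0 < a x) (a_continuous : continuous a).
Hypothesis rho_gt0 : forall x, 0 < rho x.
Hypothesis a_int_pos :
  (\int[mu]_(x in `[0%R, +oo[) ((a x)^-1)%:E = +oo)%E.
Hypothesis a_int_neg :
  (\int[mu]_(x in `]-oo, 0%R]) ((a x)^-1)%:E = +oo)%E.
Variables (t : R) (phi : R -> R).
Hypotheses (t_gt0 : 0 < t) (Lphi : phi \in Loo).

Local Notation T := (travel_time a).
Local Notation Tinv := (travel_time_inv a).

Definition gaussian_orbit x s : R := gaussian t s * flow_group a s phi x.

(** The candidate for the weak* integral, defined at every point by an ordinary integral. *)
Definition gaussian_average x : R := \int[mu]_s gaussian_orbit x s.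

(** Joint measurability, needed for Fubini: the explicit flow is a composite of continuous maps. *)
Lemma measurable_gaussian_orbit :
  measurable_fun [set: R * R] (fun p : R * R => gaussian_orbit p.1 p.2).
Proof.
rewrite /gaussian_orbit /flow_group.
under eq_fun do rewrite flowE//.
have mT : measurable_fun [set: R] T.
  by apply: continuous_measurable_fun; exact: continuous_travel_time.
have mTinv : measurable_fun [set: R] Tinv.
  by apply: continuous_measurable_fun; exact: continuous_travel_time_inv.
apply: measurable_funM.
  exact: (measurableT_comp (@measurable_gaussian _ t) measurable_snd).
apply: (measurableT_comp (measurable_Loo Lphi)).
apply: (measurableT_comp mTinv); apply: measurable_funD.
  exact: (measurableT_comp mT measurable_fst).
exact: (measurableT_comp (@oppr_measurable R setT) measurable_snd).
Qed.

Lemma measurable_gaussian_orbit1 x : measurable_fun [set: R] (gaussian_orbit x).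
Proof.
exact: (measurableT_comp measurable_gaussian_orbit (pair1_measurable x)).
Qed.

Lemma gaussian_orbit_time x y :
  gaussian_orbit x (T x - T y) = gaussian t (T x - T y) * phi y.
Proof.
rewrite /gaussian_orbit /flow_group flowE//.
by rewrite (_ : T x + - (T x - T y) = T y) ?travel_timeK//; ring.
Qed.

(** The function [phi] is bounded only almost everywhere in space, so the bound is applied after
    passing from time [s] to position [y]. The constant is the essential bound times the Gaussian
    mass, hence uniform in [x]. *)
Lemma gaussian_orbit_bounded : exists2 M : R, 0 <= M &
  forall x, (\int[mu]_s `|gaussian_orbit x s|%:E <= M%:E)%E.
Proof.
have [M M0 phiM] := Loo_ae_bounded Lphi.
exists (M * Num.sqrt (4 * pi * t)) => [|x]; first by rewrite mulr_ge0 ?sqrtr_ge0.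
have minva : measurable_fun [set: R] (fun y => (a y)^-1).
  by apply: continuous_measurable_fun; exact: continuous_inv_speed.
have mgT : measurable_fun [set: R] (fun y => gaussian t (T x - T y)).
  apply: (measurableT_comp (@measurable_gaussian _ t)).
  apply: measurable_funB => //.
  by apply: continuous_measurable_fun; exact: continuous_travel_time.
have mnphi : measurable_fun [set: R] (fun y => `|phi y|).
  exact: (measurableT_comp (@normr_measurable R setT) (measurable_Loo Lphi)).
have mabs : measurable_fun [set: R] (fun s => `|gaussian_orbit x s|).
  exact: (measurableT_comp (@normr_measurable R setT)
    (measurable_gaussian_orbit1 x)).
rewrite (integral_time a_gt0 a_continuous a_int_pos a_int_neg x mabs).
under eq_integral do rewrite gaussian_orbit_time normrM
  (ger0_norm (gaussian_ge0 _ _)).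
rewrite EFinM -integral_gaussian//.
rewrite (integral_time a_gt0 a_continuous a_int_pos a_int_neg x
  (@measurable_gaussian _ t)).
have inva_ge0 y : 0 <= (a y)^-1 by rewrite invr_ge0 ltW.
have mg : measurable_fun [set: R] (fun y => (gaussian t (T x - T y) / a y)).
  exact: measurable_funM.
rewrite -ge0_integralZl_EFin//; last 2 first.
- by move=> y _; rewrite lee_fin mulr_ge0 ?gaussian_ge0.
- by apply: measurableT_comp.
apply: ae_ge0_le_integral => //.
- by move=> y _; rewrite lee_fin !mulr_ge0 ?gaussian_ge0.
- apply: measurableT_comp => //; apply: measurable_funM => //.
  exact: measurable_funM.
- by move=> y _; rewrite -EFinM lee_fin !mulr_ge0 ?gaussian_ge0.
- under eq_fun do rewrite -EFinM.
  by apply: measurableT_comp => //; exact: measurable_funM.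
apply: (@filterS _ _ (ae_filter_ringOfSetsType mu) _ _ _ phiM) => y yM _.
rewrite -EFinM lee_fin mulrA [M * _]mulrC.
by rewrite ler_wpM2r// ler_wpM2l// gaussian_ge0.
Qed.

Lemma integrable_gaussian_orbit x :
  mu.-integrable [set: R] (EFin \o gaussian_orbit x).
Proof.
have [M _ orbM] := gaussian_orbit_bounded.
apply/integrableP; split.
  by apply/measurable_EFinP; exact: measurable_gaussian_orbit1.
exact: le_lt_trans (orbM x) (ltry _).
Qed.

Lemma gaussian_averageE x : (\int[mu]_s (gaussian_orbit x s)%:E =
  (gaussian_average x)%:E)%E.
Proof.
by rewrite /gaussian_average /Rintegral fineK// (integrable_fin_num measurableT)//;
  exact: integrable_gaussian_orbit.
Qed.

(** The same substitution, first for absolute values to get integrability, then for the integral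
    itself; it holds at every [x]. *)
Lemma gaussian_average_heat_kernel x :
  mu.-integrable [set: R] (fun y => (rho y * heat_kernel a rho t x y * phi y)%:E)
  /\ (Num.sqrt (4 * pi * t))^-1 * gaussian_average x =
     \int[mu]_y (rho y * heat_kernel a rho t x y * phi y).
Proof.
pose c := (Num.sqrt (4 * pi * t))^-1.
pose k y := gaussian_orbit x (T x - T y) / a y.
have kE y : rho y * heat_kernel a rho t x y * phi y = c * k y.
  by rewrite mul_heat_kernelE// /k gaussian_orbit_time /c -!mulrA [phi y / _]mulrC.
have morb := measurable_gaussian_orbit1 x.
have mk : measurable_fun [set: R] k.
  apply: measurable_funM; last first.
    by apply: continuous_measurable_fun; exact: continuous_inv_speed.
  apply: (measurableT_comp morb); apply: measurable_funB => //.
  by apply: continuous_measurable_fun; exact: continuous_travel_time.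
have ik : mu.-integrable [set: R] (EFin \o k).
  apply/integrableP; split; first exact/measurable_EFinP.
  have mabs : measurable_fun [set: R] (fun s => `|gaussian_orbit x s|).
    exact: (measurableT_comp (@normr_measurable R setT) morb).
  have [_] := integrableP _ _ _ (integrable_gaussian_orbit x).
  rewrite /= (integral_time a_gt0 a_continuous a_int_pos a_int_neg x mabs).
  apply: le_lt_trans; rewrite le_eqVlt; apply/orP; left; apply/eqP.
  apply: eq_integral => y _; rewrite /= /k normrM.
  by rewrite [`|(a y)^-1|]ger0_norm// invr_ge0 ltW.
under eq_Rintegral do rewrite kE.
under eq_fun do rewrite kE.
split; first exact: (integrableZl measurableT c ik).
rewrite (RintegralZl _ measurableT ik); congr (_ * _).
rewrite /gaussian_average /Rintegral; congr fine.
exact: (integral_time a_gt0 a_continuous a_int_pos a_int_neg x morb).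
Qed.

Lemma Loo_gaussian_average : gaussian_average \in Loo.
Proof.
have [M M0 orbM] := gaussian_orbit_bounded.
have morb : measurable_fun [set: R * R]
    (fun p : R * R => (gaussian_orbit p.1 p.2)%:E).
  exact: (measurableT_comp _ measurable_gaussian_orbit).
apply: (@bounded_Loo _ _ M).
  (* Tonelli gives measurability of partial integrals of nonnegative functions, hence the split into
     positive and negative parts. *)
  have -> : gaussian_average = fine \o (fun x =>
      (\int[mu]_s (EFin \o gaussian_orbit x)^\+ s -
       \int[mu]_s (EFin \o gaussian_orbit x)^\- s)%E).
    by apply/funext => x; rewrite /gaussian_average /Rintegral integralE.
  apply: (measurableT_comp (@fine_measurable R setT measurableT)).
  apply: emeasurable_funB.
  - have := measurable_fun_fubini_tonelli_F (m2 := mu) _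
      (measurable_funepos morb) (funepos_ge0 _).
    apply: eq_measurable_fun => x _; apply: eq_integral => s _.
    by rewrite !funeposE.
  - have := measurable_fun_fubini_tonelli_F (m2 := mu) _
      (measurable_funeneg morb) (funeneg_ge0 _).
    apply: eq_measurable_fun => x _; apply: eq_integral => s _.
    by rewrite !funenegE.
move=> x; have iorb := integrable_gaussian_orbit x.
apply: (le_trans (le_normr_Rintegral measurableT iorb)).
rewrite -lee_fin /Rintegral fineK; first exact: orbM.
exact: (integrable_fin_num measurableT (integrable_norm iorb)).
Qed.

(** Fubini for the product of [rho * psi] with the orbit: the first is integrable and the orbit has
    absolute integral in [s] bounded uniformly in [x], so the double integral converges
    absolutely. *)
Lemma is_wstar_integral_gaussian_average :
  is_wstar_integral rho
    (fun s y => expR (- (s ^+ 2 / (4 * t))) * flow_group a s phi y)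
    gaussian_average.
Proof.
split; first exact: Loo_gaussian_average.
move=> psi L1psi; pose u x := rho x * psi x.
have iu : mu.-integrable [set: R] (EFin \o u) := L1psi.
have mu_u : measurable_fun [set: R] u.
  by have /measurable_int/measurable_EFinP := iu.
(* The first coordinate is time, the second is space. *)
pose f (p : R * R) := (u p.2 * gaussian_orbit p.2 p.1)%:E.
have mf : measurable_fun [set: R * R] f.
  apply: (measurableT_comp (@EFin_measurable _ setT)).
  apply: measurable_funM; first exact: (measurableT_comp mu_u measurable_snd).
  apply: (measurableT_comp measurable_gaussian_orbit
    (g := fun p : R * R => (p.2, p.1))).
  by apply: measurable_fun_pair; [exact: measurable_snd|exact: measurable_fst].
have [M M0 orbM] := gaussian_orbit_bounded.
have absE x : (\int[mu]_s `|f (s, x)| =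
    `|u x|%:E * \int[mu]_s `|gaussian_orbit x s|%:E)%E.
  rewrite -ge0_integralZl_EFin//.
    by apply: eq_integral => s _; rewrite /f/= normrM EFinM.
  apply: (measurableT_comp (@EFin_measurable _ setT)).
  exact: (measurableT_comp (@normr_measurable R setT)
    (measurable_gaussian_orbit1 x)).
have if2 : (mu \x mu)%E.-integrable [set: R * R] f.
  have [_] := @integrable21ltyP _ _ _ _ _ mu mu f mf; apply.
  have [_] := integrableP _ _ _ (integrableZl measurableT M iu).
  apply: le_lt_trans.
  apply: ge0_le_integral => //.
  - by move=> x _; rewrite integral_ge0.
  - apply: (measurable_fun_fubini_tonelli_G (m1 := mu) (abse \o f)).
      exact: (measurableT_comp (@abse_measurable R setT) mf).
    by move=> p; rewrite /= lee_fin normr_ge0.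
  - have [mMu _] := integrableP _ _ _ (integrableZl measurableT M iu).
    by have := measurableT_comp (@abse_measurable R setT) mMu.
  - move=> x _; apply: (@le_trans _ _
      (`|u x|%:E * \int[mu]_s `|gaussian_orbit x s|%:E)%E).
      by rewrite le_eqVlt; apply/orP; left; apply/eqP; exact: absE.
    rewrite abseM muleC [`|M%:E|%E]gee0_abs ?lee_fin//.
    by rewrite lee_wpmul2r.
have FE x : (\int[mu]_s f (s, x) = (u x * gaussian_average x)%:E)%E.
  rewrite /f/= EFinM -gaussian_averageE.
  under eq_integral do rewrite EFinM.
  by rewrite (integralZl measurableT (integrable_gaussian_orbit x)).
pose G s := (\int[mu]_x f (s, x))%E.
have GE s : pairing rho psi (fun y => expR (- (s ^+ 2 / (4 * t))) *
    flow_group a s phi y) = fine (G s) by [].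
have iG : mu.-integrable [set: R] G := integrable_fubini_F if2.
have mfG : measurable_fun [set: R] (fun s => (fine (G s))%:E).
  apply: (measurableT_comp (@EFin_measurable _ setT)).
  apply: (measurableT_comp (@fine_measurable R setT measurableT)).
  exact: (measurable_int _ iG).
(* [fine] sends infinite values to 0, so it does not increase the absolute value. *)
have ifG : mu.-integrable [set: R] (fun s => (fine (G s))%:E).
  apply: le_integrable iG; [exact: measurableT|exact: mfG|move=> s _].
  by case: (G s) => [r| |]//=; rewrite normr0 leey.
split; first by under eq_fun do rewrite GE.
rewrite /pairing /Rintegral; congr fine.
under eq_integral do rewrite -FE.
rewrite -(Fubini if2); apply: ae_eq_integral => //.
  exact: (measurable_int _ iG).
(* Finiteness of [G s] for almost every [s] is enough to identify it with the real-valued pairing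
   under the integral. *)
have := integrable_ae measurableT iG.
apply: (@filterS _ _ (ae_filter_ringOfSetsType mu)) => s /(_ Logic.I) Gs _.
by rewrite -[LHS](fineK Gs).
Qed.

(** The average shows that a weak* integral exists, so [get] returns one; both pair equally with
    every integrable function and therefore agree almost everywhere. *)
Lemma semigroupE : {ae mu, forall x,
  semigroup a rho t phi x = (Num.sqrt (4 * pi * t))^-1 * gaussian_average x}.
Proof.
pose F s y := expR (- (s ^+ 2 / (4 * t))) * flow_group a s phi y.
have [LW pW] : is_wstar_integral rho F (wstar_integral rho F).
  apply: (@getPex _ [set Phi | is_wstar_integral rho F Phi]).
  by exists gaussian_average; exact: is_wstar_integral_gaussian_average.
have [La pa] := is_wstar_integral_gaussian_average.
have := pairing_inj rho_gt0 LW La (fun psi L1psi =>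
  etrans (pW psi L1psi).2 (esym (pa psi L1psi).2)).
apply: (@filterS _ _ (ae_filter_ringOfSetsType mu)) => x.
by rewrite /semigroup => <-.
Qed.

End weak_star_integral.

Unset Implicit Arguments.

Theorem proposition2p3 (R : realType) (a rho : R -> R)
  (a_gt0 : forall x, 0 < a x)
  (a_bounded : locally_bounded a)
  (a_derivable : forall x, derivable a x 1)
  (a'_bounded : locally_bounded (a^`())%classic)
  (a_int_pos :
    (\int[@lebesgue_measure R]_(x in `[0%R, +oo[) ((a x)^-1)%:E = +oo)%E)
  (a_int_neg :
    (\int[@lebesgue_measure R]_(x in `]-oo, 0%R]) ((a x)^-1)%:E = +oo)%E)
  (rho_gt0 : forall x, 0 < rho x)
  (rho_smooth : smooth rho) :
  [/\ is_kernel rho (semigroup a rho) (heat_kernel a rho),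
      forall t : R, 0 < t ->
        continuous (fun p : R * R => heat_kernel a rho t p.1 p.2)
    & forall t x : R, 0 < t ->
        (\int[@lebesgue_measure R]_y (rho y * heat_kernel a rho t x y)%:E
           = 1)%E].
Proof.
have a_continuous : continuous a.
  by move=> x; exact/differentiable_continuous/derivable1_diffP.
have rho_continuous : continuous rho.
  move=> x; apply/differentiable_continuous/derivable1_diffP.
  (* The derivative of order zero is [rho] itself. *)
  exact: (rho_smooth 0%N).
split=> [t t0|t _|t x t0]; last 2 first.
- exact: continuous_heat_kernel.
- exact: integral_heat_kernel.
split=> [|phi Lphi]; first exact: measurable_heat_kernel.
(* The exceptional null set comes only from the representative of the weak* integral; the kernel
   formula for the average holds everywhere. *)
have := semigroupE a_gt0 a_continuous rho_gt0 a_int_pos a_int_neg t0 Lphi.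
apply: (@filterS _ _ (ae_filter_ringOfSetsType _)) => x ->.
exact: gaussian_average_heat_kernel.
Qed.
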